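(* Let $n\to\infty$, and let $N=N(n)$ be an integer with $3n\le N\le ne^{2n}$ and $p=p(n)\in(0,1]$. The following hold asymptotically almost surely as $n\to\infty$. (i) If $p\ge \left(\log\frac{N}{n}\right)/(6n)$, then $\frac14 pnN\le \mathrm{ex}(G(N,p),P_{n+1})\le 18pnN$. (ii) Let $\omega=\left(\log\frac{N}{n}\right)/(np)$. If $N^{-1}\le p\le \left(\log\frac{N}{n}\right)/(6n)$, then \[\frac{1}{75}\frac{\omega}{\log\omega}pnN\le \mathrm{ex}(G(N,p),P_{n+1})\le 8\frac{\omega}{\log\omega}pnN.\]
   Context: $G(N,p)$ denotes the Erdős–Rényi random graph on vertex set $[N]$ in which each pair is an edge independently with probability $p$. $P_k$ denotes the path on $k$ vertices. For graphs $G,F$, $\mathrm{ex}(G,F)$ is the maximum number of edges in an $F$-free subgraph of $G$. All logarithms are natural. ''Asymptotically almost surely'' means with probability tending to $1$ as $n\to\infty$. *)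

(* Defs.v *)
From HB Require Import structures.
From mathcomp Require Import all_boot all_order all_algebra.
From mathcomp Require Import reals sequences exp.
Set Implicit Arguments. Unset Strict Implicit. Unset Printing Implicit Defensive.
Import Order.TTheory GRing.Theory Num.Theory.

(* A graph on vertex set 'I_N (= [N]) is a set of ordered pairs (u,v) with u < v;
   each such pair stands for the unordered edge {u,v}. *)
Definition pairs (N : nat) : {set 'I_N * 'I_N} := [set e : 'I_N * 'I_N | (e.1 < e.2)%N].

Definition adj (N : nat) (F : {set 'I_N * 'I_N}) (u v : 'I_N) : bool :=
  ((u, v) \in F) || ((v, u) \in F).

(* F contains a copy of the path P_{k+1} (k+1 distinct vertices, k edges). *)
Definition has_path (N k : nat) (F : {set 'I_N * 'I_N}) : bool :=
  [exists f : {ffun 'I_k.+1 -> 'I_N},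
     injectiveb f &&
     [forall i : 'I_k, adj F (f (widen_ord (leqnSn k) i)) (f (lift ord0 i))]].

Definition ex_path (N k : nat) (E : {set 'I_N * 'I_N}) : nat :=
  \max_(F : {set 'I_N * 'I_N} | (F \subset E) && ~~ has_path k F) #|F|.

Definition gnp_prob (R : realType) (N : nat) (p : R)
    (A : pred {set 'I_N * 'I_N}) : R :=
  (\sum_(E : {set 'I_N * 'I_N} | (E \subset pairs N) && A E)
      p ^+ #|E| * (1 - p) ^+ (#|pairs N| - #|E|))%R.

(* Main.v *)
Require Import Defs.
From HB Require Import structures.
From mathcomp Require Import all_boot all_order all_algebra.
From mathcomp Require Import reals sequences exp.
From mathcomp Require Import zify ring lra.
Set Implicit Arguments. Unset Strict Implicit. Unset Printing Implicit Defensive.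
Import Order.TTheory GRing.Theory Num.Theory.
Local Open Scope ring_scope.

(** Upper bounds. A depth-first search of a [P_{n+1}]-free graph has a stack of at
    most [n] vertices, and every edge from a visited to an unvisited vertex starts
    on the stack. Cutting the order of discovery into [k = N %/ n] blocks [A] of
    size [m], between [n] and about [4n/3], therefore covers the graph by [k] sets
    of pairs, each of them the pairs meeting [A] and contained in [A :|: B] for
    some [B] with [n] elements. A union bound over [A] and [B], with the
    exponential moment of the number of edges at [x = 8] in (i) and [x = omega]
    in (ii), bounds them all.

    Lower bounds. In (i), keep the edges inside disjoint blocks of [n] vertices. In
    (ii), take [k] disjoint centre blocks of size [b = (n - 1) / 2] and attach each
    other vertex to one centre block in which it has at least [d] neighbours, if
    there is one: the paths of the resulting graph have at most [2b + 1] vertices.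
    With [x = log (N / n) / log omega], the choice [d = 1] for small [x] and
    [d = floor (x / 3)] otherwise lets each vertex be attached with probability at
    least [1 / 4], independently. *)

(** * Random subsets *)

Section RandomSubset.
Variables (R : realType) (T : finType) (p : R).
Implicit Types (D S E : {set T}) (f g : {set T} -> R).

(** The expectation of [f] at a random subset of [D] that keeps each element independently with
    probability [p]; [D = pairs N] gives G(N,p). *)
Definition expect D f : R :=
  \sum_(E : {set T} | E \subset D) p ^+ #|E| * (1 - p) ^+ (#|D| - #|E|) * f E.

Lemma expect_union D1 D2 f : [disjoint D1 & D2] ->
  expect (D1 :|: D2) f = expect D1 (fun E1 => expect D2 (fun E2 => f (E1 :|: E2))).
Proof.
move=> dD; rewrite /expect.
under [RHS]eq_bigr => E1 _ do rewrite big_distrr /=.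
rewrite pair_big_dep /=.
(* A subset of the union corresponds to its traces on [D1] and [D2], and its weight is the product
   of theirs. *)
rewrite (reindex_onto (fun q : {set T} * {set T} => q.1 :|: q.2)
           (fun E => (E :&: D1, E :&: D2))) /=; last first.
  by move=> E sE; rewrite -setIUr; apply/setIidPl.
have dD21 : D2 :&: D1 = set0 by apply/eqP; rewrite setI_eq0 disjoint_sym.
have dD12 : D1 :&: D2 = set0 by apply/eqP; rewrite setI_eq0.
have capE (E1 E2 : {set T}) : E1 \subset D1 -> E2 \subset D2 ->
    (E1 :|: E2) :&: D1 = E1 /\ (E1 :|: E2) :&: D2 = E2.
  move=> s1 s2; rewrite !setIUl (setIidPl s1) (setIidPl s2); split.
    suff -> : E2 :&: D1 = set0 by rewrite setU0.
    by apply/eqP; rewrite -subset0 -dD21 setSI.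
  suff -> : E1 :&: D2 = set0 by rewrite set0U.
  by apply/eqP; rewrite -subset0 -dD12 setSI.
apply: eq_big => [[E1 E2] /=|[E1 E2] /= /andP[_ /eqP[e1 e2]]].
  apply/andP/andP => [[_ /eqP[e1 e2]]|[s1 s2]].
    by split; [rewrite -e1|rewrite -e2]; rewrite subsetIr.
  by have [-> ->] := capE _ _ s1 s2; rewrite setUSS.
have s1 : E1 \subset D1 by rewrite -e1 subsetIr.
have s2 : E2 \subset D2 by rewrite -e2 subsetIr.
have d12 : [disjoint E1 & E2] by rewrite (disjointWl s1) ?(disjointWr s2).
move: d12; rewrite -leq_card_setU => /eqP ->.
move: dD; rewrite -leq_card_setU => /eqP ->.
have := subset_leq_card s1; have := subset_leq_card s2 => l2 l1.
rewrite subnDA -addnBAC // -addnBA // !exprD; ring.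
Qed.

Lemma sum_subset_card D (a b : R) :
  \sum_(E : {set T} | E \subset D) a ^+ #|E| * b ^+ (#|D| - #|E|) =
  (a + b) ^+ #|D|.
Proof.
rewrite addrC exprDn.
rewrite (partition_big (fun E : {set T} => inord #|E| : 'I_#|D|.+1) predT) //=.
apply: eq_bigr => i _.
rewrite (eq_bigl (fun E : {set T} => E \in [set A : {set T} | A \subset D & #|A| == i])).
  rewrite (eq_bigr (fun=> b ^+ (#|D| - i) * a ^+ i)); last first.
    by move=> E; rewrite inE => /andP[_ /eqP ->]; rewrite mulrC.
  by rewrite sumr_const cards_draws.
move=> E; rewrite inE; case sE: (E \subset D) => //=.
by rewrite -val_eqE /= inordK // ltnS subset_leq_card.
Qed.

Lemma eq_expect D f g : (forall E, E \subset D -> f E = g E) ->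
  expect D f = expect D g.
Proof. by move=> e; apply: eq_bigr => E /e ->. Qed.

Lemma expectZ D c f : expect D (fun E => c * f E) = c * expect D f.
Proof. by rewrite /expect mulr_sumr; apply: eq_bigr => E _; ring. Qed.

Lemma expectD D f g :
  expect D (fun E => f E + g E) = expect D f + expect D g.
Proof. by rewrite /expect -big_split; apply: eq_bigr => E _ /=; ring. Qed.

Lemma expect_sum (I : finType) (P : pred I) D (F : I -> {set T} -> R) :
  expect D (fun E => \sum_(i | P i) F i E) = \sum_(i | P i) expect D (F i).
Proof.
rewrite /expect exchange_big /=; apply: eq_bigr => E _.
by rewrite mulr_sumr.
Qed.

Lemma expect_exp D (x : R) :
  expect D (fun E => x ^+ #|E|) = (1 + (x - 1) * p) ^+ #|D|.
Proof.
rewrite (_ : 1 + _ = p * x + (1 - p)); last by ring.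
rewrite -sum_subset_card; apply: eq_bigr => E _.
by rewrite exprMn; ring.
Qed.

Lemma expect1 D : expect D (fun=> 1) = 1.
Proof.
(* The total mass is the case [x = 1] of [expect_exp]. *)
rewrite -[RHS](expr1n _ #|D|) -[in RHS](addr0 1) -[in RHS](mul0r p) -(subrr 1).
by rewrite -expect_exp; apply: eq_expect => E _; rewrite expr1n.
Qed.

(** Independence of the traces of the random set on [S] and on its complement in [D]. *)
Lemma expect_mul D S f g : S \subset D ->
  expect D (fun E => f (E :&: S) * g (E :&: (D :\: S))) =
  expect S f * expect (D :\: S) g.
Proof.
move=> sSD; rewrite -{1}(setID D S) (setIidPr sSD) expect_union; last first.
  by rewrite -setI_eq0; apply/eqP/setP => z; rewrite !inE; case: (z \in S).
rewrite mulrC -expectZ; apply: eq_expect => E1 s1.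
rewrite mulrC -expectZ; apply: eq_expect => E2 s2.
rewrite !setIUl (setIidPl s1) (setIidPl s2).
have -> : E2 :&: S = set0.
  apply/setP=> z; rewrite !inE; apply/negP => /andP[/(subsetP s2)].
  by rewrite inE => /andP[/negbTE->].
have -> : E1 :&: (D :\: S) = set0.
  apply/setP=> z; rewrite !inE; apply/negP => /andP[/(subsetP s1)] ->.
  by [].
by rewrite setU0 set0U.
Qed.

Lemma expect_restrict D S f : S \subset D ->
  expect D (fun E => f (E :&: S)) = expect S f.
Proof.
move=> sSD; rewrite -[RHS]mulr1 -(expect1 (D :\: S)) -(expect_mul f _ sSD).
by apply: eq_expect => E _; rewrite mulr1.
Qed.

Lemma expect_prod (I : eqType) (r : seq I) (S : I -> {set T})
    (f : I -> {set T} -> R) D :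
  uniq r -> {in r, forall i, S i \subset D} ->
  {in r &, forall i j, i != j -> [disjoint S i & S j]} ->
  expect D (fun E => \prod_(i <- r) f i (E :&: S i)) =
  \prod_(i <- r) expect (S i) (f i).
Proof.
elim: r D => [|i r IH] D /=.
  move=> _ _ _; rewrite big_nil -[RHS](expect1 D).
  by apply: eq_expect => E _; rewrite big_nil.
move=> /andP[ir ur] sD dS; rewrite big_cons.
have sS : {in r, forall j, S j \subset D :\: S i}.
  move=> j jr; rewrite subsetD sD ?inE ?jr ?orbT //=.
  apply: dS; rewrite ?inE ?jr ?eqxx ?orbT //.
  by apply: contraNneq ir => <-.
rewrite -(IH (D :\: S i)) //; last first.
  by move=> j l jr lr; apply: dS; rewrite inE ?jr ?lr orbT.
rewrite -expect_mul ?sD ?inE ?eqxx //.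
apply: eq_expect => E _; rewrite big_cons; congr (_ * _).
rewrite !big_seq; apply: eq_bigr => j jr; congr (f j _).
by rewrite -setIA (setIidPr (sS _ jr)).
Qed.

Hypothesis p01 : 0 <= p <= 1.

Lemma expect_le D f g : (forall E, E \subset D -> f E <= g E) ->
  expect D f <= expect D g.
Proof.
move=> fg; apply: ler_sum => E sE; apply: ler_wpM2l; last exact: fg.
by have /andP[p0 p1] := p01; apply: mulr_ge0; apply: exprn_ge0; lra.
Qed.

Lemma expect_ge0 D f : (forall E, E \subset D -> 0 <= f E) -> 0 <= expect D f.
Proof.
move=> f0; rewrite -(mul0r (expect D (fun=> 1))) -expectZ.
by apply: expect_le => E sE; rewrite mul0r f0.
Qed.

(** The exact moment is [(1 + (x - 1) p) ^ #|S|], and [1 + t <= expR t]. All tail estimates for edge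
    counts start from here. *)
Lemma expect_exp_restrict D S (x : R) : S \subset D -> 0 <= x ->
  expect D (fun E => x ^+ #|E :&: S|) <= expR ((x - 1) * p * #|S|%:R).
Proof.
move=> sSD x0; rewrite (expect_restrict (fun E => x ^+ #|E|)) // expect_exp.
rewrite expRM_natr lerXn2r ?nnegrE ?expR_ge0 //; last exact: expR_ge1Dx.
by have /andP[p0 p1] := p01; nra.
Qed.

End RandomSubset.

(** * Depth-first search and path-free graphs *)

Section SeparationOrder.
Local Open Scope nat_scope.
Variables (T : finType) (e : rel T).
Hypothesis e_sym : symmetric e.

(* State of a depth-first search: [S] is the set of visited vertices, [P] the
   stack, which carries all edges leaving [S]. *)
Definition search_state (S : {set T}) (P : seq T) :=
  [/\ uniq P, sorted e P, {subset P <= S}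
    & forall u v, u \in S -> v \notin S -> e u v -> u \in P].

(** Push an unvisited neighbour of the top of the stack; if there is none, pop the top, which then
    carries no edge leaving [S], and recurse; on an empty stack start from any unvisited vertex. *)
Lemma search_step S P : S != setT -> search_state S P ->
  exists w P', w \notin S /\ search_state (w |: S) P'.
Proof.
move=> SnT; elim: P => [|x P IH] [uP sP PS cP].
  have [w wS] : exists w, w \notin S.
    apply/existsP; rewrite -negb_forall; apply: contra SnT => /forallP h.
    by apply/eqP/setP => z; rewrite inE h.
  exists w, [:: w]; split => //; split => // [z|u v].
    by rewrite !inE => /eqP ->; rewrite eqxx.
  rewrite !inE negb_or => /orP[-> //|uS] /andP[_ vS] /(cP _ _ uS vS).
  by rewrite in_nil.
case: (pickP (fun w => (w \notin S) && e x w)) => [w /andP[wS exw]|noW].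
  exists w, (w :: x :: P); split => //; split.
  - by rewrite cons_uniq uP andbT; apply: contra wS => /PS.
  - by rewrite /= e_sym exw.
  - move=> z; rewrite in_cons => /orP[/eqP ->|/PS zS]; rewrite !inE ?eqxx //.
    by rewrite zS orbT.
  - move=> u v; rewrite in_cons !inE negb_or => /orP[->//|uS] /andP[_ vS] euv.
    by have := cP _ _ uS vS euv; rewrite inE => ->; rewrite orbT.
apply: IH; split.
- by move: uP => /= /andP[].
- by move: sP => /= /path_sorted.
- by move=> z zP; apply: PS; rewrite inE zP orbT.
- move=> u v uS vS euv; have := cP _ _ uS vS euv.
  rewrite inE => /orP[/eqP ux|//].
  by have := noW v; rewrite vS -ux euv.
Qed.

(** [s] is the order of discovery, and [B] is the stack at the moment when the prefix has just been
    visited: it spans a path, hence has at most [n] vertices. *)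
Lemma separation_order n :
  (forall P : seq T, uniq P -> sorted e P -> size P <= n) ->
  exists s : seq T, [/\ uniq s, forall x, x \in s &
    forall i, exists B : {set T}, #|B| <= n /\
      forall u v, u \in take i s -> v \notin take i s -> e u v -> u \in B].
Proof.
move=> Pn.
have card_stack P : uniq P -> sorted e P -> #|[set x in P]| <= n.
  by move=> uP sP; rewrite cardsE; apply: leq_trans (card_size _) (Pn _ uP sP).
suff H j : j <= #|T| -> exists s : seq T, [/\ uniq s, size s = j,
    exists P, search_state [set x in s] P &
    forall i, exists B : {set T}, #|B| <= n /\
      forall u v, u \in take i s -> v \notin take i s -> e u v -> u \in B].
  have [s [us ss _ Hs]] := H _ (leqnn _); exists s; split => // x.
  have /eqP e1 : [set x in s] == setT.
    by rewrite eqEcard subsetT cardsT cardsE (card_uniqP us) ss leqnn.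
  by have := in_setT x; rewrite -e1 inE.
elim: j => [_|j IH jT].
  exists [::]; split => //.
    by exists [::]; split => // u v; rewrite inE.
  by move=> i; exists set0; rewrite cards0; split.
have [s [us ss [P sP] Hs]] := IH (ltnW jT).
have [|w [P' [wS sP']]] := search_step _ sP.
  apply/eqP => sT; move: jT; rewrite -cardsT -sT cardsE (card_uniqP us) ss.
  by rewrite ltnn.
rewrite inE in wS.
have ES : w |: [set x in s] = [set x in rcons s w].
  by apply/setP => z; rewrite !inE mem_rcons inE.
rewrite ES in sP'.
exists (rcons s w); split; rewrite ?rcons_uniq ?wS ?size_rcons ?ss //.
  by exists P'.
(* Prefixes of length at most [j] are unchanged; the only new one is the whole list, separated by
   the current stack. *)
move=> i; case: (leqP i j) => ij.
  have -> : take i (rcons s w) = take i s by rewrite -cats1 takel_cat // ss.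
  exact: Hs.
rewrite take_oversize ?size_rcons ?ss //.
case: sP' => uP' srt _ cP'; exists [set x in P']; split; first exact: card_stack.
by move=> u v us' vs' euv; rewrite inE; apply: (cP' u v); rewrite ?inE.
Qed.

Lemma superset_card (A : {set T}) m : #|A| <= m <= #|T| ->
  exists2 A' : {set T}, A \subset A' & #|A'| = m.
Proof.
move=> /andP[]; elim: m => [|m IH] Am mT.
  by exists A => //; apply/eqP; rewrite -leqn0.
move: Am; rewrite leq_eqVlt => /orP[/eqP|Am]; first by exists A.
have [A' AA' cA'] := IH Am (ltnW mT).
have [w wA] : exists w, w \notin A'.
  apply/existsP; rewrite -negb_forall; apply/negP => /forallP h.
  suff : #|T| <= #|A'| by rewrite cA' leqNgt mT.
  by apply: subset_leq_card; apply/subsetP => z _; rewrite h.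
by exists (w |: A'); rewrite ?cardsU1 ?wA ?cA' // (subset_trans AA') // subsetU1.
Qed.

End SeparationOrder.

(** * Covering a path-free graph by few sets of pairs *)

Section PathCover.
Local Open Scope nat_scope.
Variable N : nat.
Implicit Types (F E : {set 'I_N * 'I_N}) (A B : {set 'I_N}).

Lemma adj_sym F : symmetric (adj F).
Proof. by move=> u v; rewrite /adj orbC. Qed.

Lemma path_free_size n F (P : seq 'I_N) :
  ~~ has_path n F -> uniq P -> sorted (adj F) P -> size P <= n.
Proof.
move=> nF uP sP; rewrite leqNgt; apply: contra nF => nP.
have x0 : 'I_N by case: P nP {uP sP}.
apply/existsP; exists [ffun i : 'I_n.+1 => nth x0 P i]; apply/andP; split.
  apply/injectiveP => i j; rewrite !ffunE => /eqP.
  rewrite nth_uniq ?(leq_trans (ltn_ord _)) // => /eqP ij.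
  exact: val_inj.
apply/forallP => i; rewrite !ffunE /= /bump leq0n add1n.
by move/sortedP: sP; apply; apply: leq_ltn_trans (ltn_ord i) nP.
Qed.

Definition near_pairs A B : {set 'I_N * 'I_N} :=
  [set e in pairs N | ((e.1 \in A) && (e.2 \in A :|: B))
                   || ((e.2 \in A) && (e.1 \in A :|: B))].

(** Each pair is counted in both orientations; the reversed pairs are disjoint from [S] because its
    pairs are increasing. *)
Lemma card_pairs_sym (S : {set 'I_N * 'I_N}) (W : {set 'I_N * 'I_N}) :
  S \subset pairs N -> (forall u v, (u, v) \in S -> (u, v) \in W /\ (v, u) \in W) ->
  2 * #|S| <= #|W|.
Proof.
move=> /subsetP sS SW.
pose sw (q : 'I_N * 'I_N) := (q.2, q.1).
have sw_inj : injective sw by move=> [a b] [c d] [-> ->].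
rewrite mul2n -addnn -{2}(card_imset S sw_inj).
have dS : [disjoint S & sw @: S].
  rewrite -setI_eq0; apply/eqP/setP => q; rewrite !inE; apply/negP.
  move=> /andP[/sS qS /imsetP[[a b] /sS abS qE]]; move: qS abS.
  by rewrite qE !inE /= => /ltn_trans h /h; rewrite ltnn.
move: dS; rewrite -leq_card_setU => /eqP <-.
apply: subset_leq_card; rewrite subUset; apply/andP; split; apply/subsetP.
  by case=> u v /SW[].
by move=> _ /imsetP[[u v] /SW[_ vu] ->].
Qed.

Lemma card_near_pairs A B : 2 * #|near_pairs A B| <= #|A| ^ 2 + 2 * (#|A| * #|B|).
Proof.
pose W := setX A A :|: (setX A B :|: setX B A).
apply: leq_trans (_ : #|W| <= _).
  apply: card_pairs_sym.
    by apply/subsetP => q; rewrite inE => /andP[].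
  move=> u v; rewrite !inE /= => /andP[_].
  by case: (u \in A); case: (v \in A); case: (u \in B); case: (v \in B).
apply: leq_trans (leq_card_setU _ _) _; rewrite cardsX mulnn leq_add2l.
apply: leq_trans (leq_card_setU _ _) _.
by rewrite !cardsX (mulnC #|B|) addnn mul2n.
Qed.

(** Let the later endpoint of an edge lie in block [j]. The other one lies in block [j] too, or
    among the first [j * m] vertices; then the edge leaves that prefix and starts in the separator
    [B j]. *)
Lemma path_free_cover n m k F :
  F \subset pairs N -> ~~ has_path n F -> N <= k * m -> n <= N -> 0 < m <= N ->
  exists A B : 'I_k -> {set 'I_N},
    (forall j, #|A j| = m /\ #|B j| = n) /\
    F \subset \bigcup_j near_pairs (A j) (B j).
Proof.
move=> /subsetP sF nF Nkm nN /andP[m0 mN].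
have [s [us sT sB]] := separation_order (@adj_sym F) (fun P => path_free_size nF).
have szs : size s = N.
  rewrite -[RHS](card_ord N) -(card_uniqP us); apply: eq_card => x.
  by rewrite sT.
pose A0 (j : 'I_k) := [set v | index v s %/ m == j].
have idx v : index v s < N by rewrite -[ltnRHS]szs index_mem.
have cA0 j : #|A0 j| <= m.
  rewrite -[leqRHS]card_ord.
  pose f (v : 'I_N) : 'I_m := Ordinal (ltn_pmod (index v s) m0).
  rewrite -(card_in_imset (f := f) (D := A0 j)); first exact: max_card.
  move=> u v; rewrite !inE => /eqP qu /eqP qv /(congr1 val) /= huv.
  rewrite -(nth_index u (sT u)) -(nth_index u (sT v)); congr nth.
  by rewrite (divn_eq (index u s) m) (divn_eq (index v s) m) qu qv huv.
(* Blocks and separators are padded to exact sizes, so that the union bound ranges over sets of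
   fixed cardinality. *)
have hA j : exists A', (A0 j \subset A') && (#|A'| == m).
  have [|A' sA cA] := @superset_card _ (A0 j) m; first by rewrite cA0 card_ord.
  by exists A'; rewrite sA cA eqxx.
have hB (j : 'I_k) : exists B : {set 'I_N}, (#|B| == n) &&
    [forall u, forall v, (u \in take (j * m) s) ==> (v \notin take (j * m) s)
        ==> adj F u v ==> (u \in B)].
  have [B [cB hB]] := sB (j * m).
  have [|B' sBB cB'] := @superset_card _ B n; first by rewrite cB card_ord.
  exists B'; rewrite cB' eqxx; apply/forallP => u; apply/forallP => v.
  do 3![apply/implyP => ?]; apply: (subsetP sBB); exact: (hB u v).
exists (fun j => xchoose (hA j)), (fun j => xchoose (hB j)); split.
  move=> j; have /andP[_ /eqP ->] := xchooseP (hA j).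
  by have /andP[/eqP -> _] := xchooseP (hB j).
have key u v : adj F u v -> index u s <= index v s ->
    exists j : 'I_k, (v \in xchoose (hA j)) &&
      (u \in xchoose (hA j) :|: xchoose (hB j)).
  move=> auv iuv.
  have jk : index v s %/ m < k.
    by rewrite ltn_divLR //; apply: leq_trans (idx v) Nkm.
  exists (Ordinal jk); set j := Ordinal jk.
  have /andP[/subsetP sA _] := xchooseP (hA j).
  have /andP[_ /forallP /(_ u) /forallP /(_ v)] := xchooseP (hB j).
  rewrite sA ?inE //= auv /= => hBuv.
  case: (leqP (j * m) (index u s)) => ju.
    rewrite sA // inE eqn_leq leq_div2r //=.
    by rewrite leq_divRL.
  suff -> : u \in xchoose (hB j) by rewrite orbT.
  move: hBuv; rewrite -(in_take _ (sT u)) in ju.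
  rewrite [u \in take _ _]ju in_take // -leqNgt leq_divM /=.
  by [].
apply/subsetP => -[u v] uvF; apply/bigcupP.
have uvP := sF _ uvF.
case: (leqP (index u s) (index v s)) => h.
  have [|j hj] := key u v _ h; first by rewrite /adj uvF.
  by exists j => //; rewrite inE uvP /= hj orbT.
have [|j hj] := key v u _ (ltnW h); first by rewrite /adj uvF orbT.
by exists j => //; rewrite inE uvP /= hj.
Qed.

End PathCover.

(** * Upper bounds *)

Section Gnp.
Variables (R : realType) (N : nat) (p : R).
Implicit Types (E F : {set 'I_N * 'I_N}) (A : pred {set 'I_N * 'I_N}).

Lemma gnp_probE A : gnp_prob p A = expect p (pairs N) (fun E => (A E)%:R).
Proof.
rewrite /gnp_prob /expect big_mkcondr; apply: eq_bigr => E _ /=.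
by case: (A E); rewrite ?mulr1 ?mulr0.
Qed.

Hypothesis p01 : 0 <= p <= 1.

Lemma gnp_prob_le_expect A (g : {set 'I_N * 'I_N} -> R) :
  (forall E, 0 <= g E) -> (forall E, E \subset pairs N -> A E -> 1 <= g E) ->
  gnp_prob p A <= expect p (pairs N) g.
Proof.
move=> g0 g1; rewrite gnp_probE; apply: expect_le => // E sE.
by case: (boolP (A E)) => [/(g1 _ sE)|_].
Qed.

Lemma gnp_prob_and A1 A2 :
  1 - gnp_prob p (predC A1) - gnp_prob p (predC A2) <=
  gnp_prob p (fun E => A1 E && A2 E).
Proof.
rewrite !gnp_probE -{1}(expect1 p (pairs N)) -addrA -opprD -expectD.
rewrite -mulN1r -expectZ -expectD; apply: expect_le => // E _ /=.
by case: (A1 E); case: (A2 E) => /=; lra.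
Qed.

(** Chernoff bound for the lower tail: Markov's inequality for [expR (s * (t - #|E :&: S|))]. *)
Lemma gnp_prob_card_lt (S : {set 'I_N * 'I_N}) (s t : R) :
  S \subset pairs N -> 0 <= s ->
  gnp_prob p (fun E => #|E :&: S|%:R < t) <=
  expR (s * t - (1 - expR (- s)) * p * #|S|%:R).
Proof.
move=> sS s0.
apply: le_trans (_ : expect p (pairs N)
    (fun E => expR (s * t) * expR (- s) ^+ #|E :&: S|) <= _).
  apply: gnp_prob_le_expect => [E|E _ lt].
    by rewrite mulr_ge0 ?exprn_ge0 ?expR_ge0.
  rewrite -expRM_natr -expRD; apply: le_trans (expR_ge1Dx _).
  by rewrite lerDl mulNr -mulrBr mulr_ge0 // subr_ge0 ltW.
rewrite expectZ expRD ler_wpM2l ?expR_ge0 //.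
apply: le_trans (expect_exp_restrict _ sS _) _; rewrite ?expR_ge0 //.
by rewrite -!mulNr opprB.
Qed.

Lemma ex_path_witness n E : (0 < n)%N ->
  exists F, [/\ F \subset E, ~~ has_path n F & ex_path n E = #|F|].
Proof.
move=> n0; pose Q := [pred F : {set 'I_N * 'I_N} | (F \subset E) && ~~ has_path n F].
have Q0 : (0 < #|Q|)%N.
  apply/card_gt0P; exists set0; rewrite inE sub0set /=.
  apply/existsP => -[f /andP[_ /forallP /(_ (Ordinal n0))]].
  by rewrite /adj !inE.
have [F] := eq_bigmax_cond (fun F : {set 'I_N * 'I_N} => #|F|) Q0.
by rewrite inE => /andP[sF nF] eF; exists F.
Qed.

Lemma ex_path_ge n E F : F \subset E -> ~~ has_path n F -> (#|F| <= ex_path n E)%N.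
Proof.
by move=> sF nF; apply: (@leq_bigmax_cond _ _ (fun F : {set _} => #|F|)); rewrite sF.
Qed.

(** If the extremal [F] has more than [t] edges, one of the [k] covering sets contains at least
    [t / k] edges of [E]. The bound sums, over all candidates for [(A, B)], Markov's inequality for
    [x ^+ #|E :&: near_pairs A B|]. *)
Lemma ex_path_upper_tail n k m (x t : R) :
  (0 < n <= N)%N -> (0 < m <= N)%N -> (N <= k * m)%N -> 1 <= x ->
  gnp_prob p (fun E => ~~ ((ex_path n E)%:R <= t)) <=
  ('C(N, m) * 'C(N, n))%:R *
  expR ((x - 1) * p * (m%:R ^+ 2 / 2 + m%:R * n%:R) - ln x * (t / k%:R)).
Proof.
move=> /andP[n0 nN] /andP[m0 mN] Nkm x1.
have k0 : (0 < k)%N by rewrite lt0n; apply/eqP => k0; rewrite k0 mul0n in Nkm; lia.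
have k0R : 0 < k%:R :> R by rewrite ltr0n.
have x0 : 0 < x by lra.
pose Q := setX [set A : {set 'I_N} | #|A| == m] [set B : {set 'I_N} | #|B| == n].
pose c := expR (- (ln x * (t / k%:R))).
pose g E := \sum_(q in Q) c * x ^+ #|E :&: near_pairs q.1 q.2|.
apply: (@le_trans _ _ (expect p (pairs N) g)).
  apply: gnp_prob_le_expect => [E|E sE].
    by apply: sumr_ge0 => q _; rewrite mulr_ge0 ?expR_ge0 ?exprn_ge0 ?ltW.
  rewrite -ltNge => tex; have [F [sF nF eF]] := ex_path_witness E n0.
  have [|A [B [cAB Fc]]] :=
    path_free_cover (subset_trans sF sE) nF Nkm nN; first by rewrite m0.
  have [j tj] : exists j : 'I_k, t / k%:R <= #|E :&: near_pairs (A j) (B j)|%:R.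
    apply/existsP; rewrite -[[exists _, _]]negbK negb_exists; apply/negP => /forallP h.
    suff : #|F|%:R <= t by rewrite -eF leNgt tex.
    apply: le_trans (_ : (\sum_(j < k) #|E :&: near_pairs (A j) (B j)|)%:R <= _).
      rewrite ler_nat; apply: leq_trans (_ : #|\bigcup_j (E :&: near_pairs (A j) (B j))| <= _)%N.
        rewrite -big_distrr; apply: subset_leq_card => /=.
        by rewrite subsetI sF.
      elim/big_rec2: _ => [|j a S _ IH]; first by rewrite cards0.
      by apply: leq_trans (leq_card_setU _ _) _; rewrite leq_add2l.
    rewrite natr_sum; apply: le_trans (_ : \sum_(j < k) (t / k%:R) <= _).
      by apply: ler_sum => j _; have := h j; rewrite -ltNge => /ltW.
    by rewrite sumr_const card_ord -[leLHS]mulr_natr divfK ?gt_eqF.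
  have [/eqP cA /eqP cB] := cAB j.
  rewrite /g (bigD1 (A j, B j)) /=; last by rewrite !inE cA cB.
  rewrite -[leLHS]addr0 lerD //; last first.
    by apply: sumr_ge0 => q _; rewrite mulr_ge0 ?expR_ge0 ?exprn_ge0 ?ltW.
  rewrite -[x in x ^+ _]lnK ?posrE // -expRM_natr -expRD.
  apply: le_trans (expR_ge1Dx _); rewrite lerDl addrC -mulrBr mulr_ge0 ?ln_ge0 //.
  by rewrite subr_ge0.
rewrite /g expect_sum.
have -> : ('C(N, m) * 'C(N, n))%N = #|Q|.
  by rewrite cardsX !card_draws card_ord.
rewrite mulr_natl -sumr_const; apply: ler_sum => -[A B] /=.
rewrite !inE => /andP[/eqP cA /eqP cB].
rewrite expectZ addrC expRD ler_wpM2l ?expR_ge0 //.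
apply: le_trans (expect_exp_restrict _ _ (ltW x0)) _ => //.
  by apply/subsetP => q; rewrite inE => /andP[].
rewrite ler_expR ler_wpM2l //.
  by have /andP[p0 _] := p01; rewrite mulr_ge0 // subr_ge0.
have := card_near_pairs A B; rewrite cA cB -(ler_nat R) !(natrD, natrM, natrX).
lra.
Qed.

End Gnp.

(** * Binomial coefficients against exponentials *)

Section BinomialBounds.
Variable R : realType.

(** The quotient of [m ^ m] by [m!] is a single term of the exponential series at [m]. *)
Lemma expn_le_fact_expR m : m%:R ^+ m <= m`!%:R * expR m%:R :> R.
Proof.
case: m => [|m]; first by rewrite expr0 fact0 mul1r expR0.
have := expR_ge1Dxn m (ler0n R m.+1).
have f0 : 0 < m.+1`!%:R :> R by rewrite ltr0n fact_gt0.
move=> h; rewrite mulrC -ler_pdivrMr //; lra.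
Qed.

(** From [N ^ m / m!] and the previous bound one gets [(e N / m) ^ m]. Weakening [m] to [n]
    expresses every binomial coefficient through the same [ln (N / n)]. *)
Lemma bin_le_expR N m (n : nat) : (0 < n <= m)%N -> (n <= N)%N ->
  'C(N, m)%:R <= expR (m%:R * (1 + ln (N%:R / n%:R))) :> R.
Proof.
move=> /andP[n0 nm] nN.
have n0R : 0 < n%:R :> R by rewrite ltr0n.
have m0R : 0 < m%:R :> R by rewrite ltr0n (leq_trans n0).
have N0R : 0 < N%:R :> R by rewrite ltr0n (leq_trans n0).
have f0 : 0 < m`!%:R :> R by rewrite ltr0n fact_gt0.
have ffle : (N ^_ m <= N ^ m)%N.
  elim: m {nm m0R f0} N {nN N0R} => // m IH [|N]; first by rewrite ffact0n.
  rewrite ffactSS expnS leq_mul // (leq_trans (IH N)) //.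
  by case: m {IH} => // m; rewrite leq_exp2r.
have hb : 'C(N, m)%:R * m`!%:R <= N%:R ^+ m :> R.
  by rewrite -natrM -natrX ler_nat bin_ffact.
rewrite mulrDr mulr1 expRD expRM_natl lnK ?posrE ?divr_gt0 //.
apply: le_trans (_ : N%:R ^+ m / m`!%:R <= _); first by rewrite ler_pdivlMr.
rewrite ler_pdivrMr // expr_div_n.
have hm : m%:R ^+ m <= m`!%:R * expR m%:R :> R by exact: expn_le_fact_expR.
have hn : n%:R ^+ m <= m%:R ^+ m :> R by rewrite lerXn2r ?nnegrE ?ler0n // ler_nat.
have nm0 : 0 < n%:R ^+ m :> R by rewrite exprn_gt0.
rewrite (_ : _ * m`!%:R = N%:R ^+ m * (m`!%:R * expR m%:R / n%:R ^+ m)); last first.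
  by ring.
rewrite ler_peMr ?exprn_ge0 ?ler0n //.
by rewrite ler_pdivlMr // mul1r (le_trans hn).
Qed.

End BinomialBounds.

(** * Numerical constants, block sizes and the two upper tails *)

Section Numerics.
Variable R : realType.

Lemma expR2_le8 : expR 2 <= 8 :> R.
Proof.
(* Five squarings lead from 1/16 to 2; each intermediate value is rounded up to a short decimal. *)
have h0 : expR (1 / 16) <= 16 / 15 :> R.
  have h : 15 / 16 <= expR (- (1 / 16)) :> R by apply: le_trans (expR_ge1Dx _); lra.
  rewrite -[expR _]invrK -expRN (_ : 16 / 15 = (15 / 16)^-1); last by field.
  by rewrite lef_pV2 // posrE ?expR_gt0 //; lra.
have dbl (y b c : R) : expR y <= b -> b ^+ 2 <= c -> expR (2 * y) <= c.
  move=> hb; apply: le_trans; rewrite expRM_natl.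
  by rewrite lerXn2r ?nnegrE ?expR_ge0 // (le_trans (expR_ge0 y)).
have -> : (2 : R) = 2 * (2 * (2 * (2 * (2 * (1 / 16))))) by field.
apply: (dbl _ (282 / 100)); last by lra.
apply: (dbl _ (1678 / 1000)); last by lra.
apply: (dbl _ (12952 / 10000)); last by lra.
apply: (dbl _ (1138 / 1000)); last by lra.
by apply: dbl h0 _; lra.
Qed.

Lemma expR1_le3 : expR 1 <= 3 :> R.
Proof.
have := expR2_le8; have := expR_ge0 (1 : R).
have -> : expR 2 = expR 1 ^+ 2 :> R by rewrite -expRM_natl mulr1.
by nra.
Qed.

Lemma ln_ge (a b : R) : expR a <= b -> a <= ln b.
Proof.
move=> h; rewrite -(expRK a) ler_ln ?posrE ?expR_gt0 //.
exact: lt_le_trans (expR_gt0 a) h.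
Qed.

Lemma ln8_ge2 : 2 <= ln 8 :> R.
Proof. exact: ln_ge expR2_le8. Qed.

Lemma ln6_ge : 3 / 2 <= ln 6 :> R.
Proof.
apply: ln_ge; have e0 := expR_ge0 (3 / 2 : R); have := expR1_le3.
have : expR (3 / 2) ^+ 2 = expR 1 ^+ 3 :> R.
  by rewrite -!expRM_natl; congr expR; field.
have := expR_ge0 (1 : R).
move=> h1 h2 h3.
have : expR 1 ^+ 3 <= 3 ^+ 3 :> R by rewrite lerXn2r // nnegrE.
rewrite -h2; nra.
Qed.

Lemma ln_ratio_ge1 (N n : nat) : (0 < n)%N -> (3 * n <= N)%N ->
  1 <= ln (N%:R / n%:R) :> R.
Proof.
move=> n0 nN; apply: ln_ge; apply: le_trans expR1_le3 _.
by rewrite ler_pdivlMr ?ltr0n // -natrM ler_nat.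
Qed.

(** Since [k >= 3], [N < (k + 1) n <= 4 k n / 3]. This bounds [N %/ k] by [4 n / 3], and shows that
    [k] blocks of size [n] fill three quarters of the vertices. *)
Lemma block_size (N n : nat) : (3 <= n)%N -> (3 * n <= N)%N ->
  let k := (N %/ n)%N in let m := (N %/ k).+1 in
  [/\ (3 <= k)%N, (k * n <= N)%N, (N <= k * m)%N, (k * m.-1 <= N)%N &
      [/\ (n < m)%N, (3 * m <= 4 * n + 3)%N, (m <= N)%N & (3 * N <= 4 * (k * n))%N]].
Proof.
move=> n3 nN k m.
have n0 : (0 < n)%N by lia.
have k3 : (3 <= k)%N by rewrite leq_divRL.
have k0 : (0 < k)%N by lia.
have kn : (k * n <= N)%N by rewrite leq_divM.
have Nk : (N < k.+1 * n)%N by rewrite ltn_ceil.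
have Nkm : (N < m * k)%N by rewrite ltn_ceil.
have mk : ((N %/ k) * k <= N)%N by rewrite leq_divM.
have nm : (n <= N %/ k)%N by rewrite leq_divRL // mulnC.
have h3 : (3 * (N %/ k) <= 4 * n)%N.
  rewrite -(leq_pmul2r k0); nia.
split => //; rewrite ?(mulnC k) ?[m.-1]/= //; first exact: ltnW.
by split => //; rewrite /m; nia.
Qed.

(** [ex_path_upper_tail] with [t = c N]: [m <= 4 n / 3 + 1] bounds the number of near pairs,
    [k (m - 1) <= N] gives [t / k >= c (m - 1)], and [ln (N / n) >= 1] absorbs the factor [e] in the
    binomials. *)
Lemma ex_path_upper (N n : nat) (p x c : R) :
  (3 <= n)%N -> (3 * n <= N)%N -> 0 <= p <= 1 -> 1 <= x -> 0 <= c ->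
  exists m : nat, [/\ n%:R + 1 <= m%:R :> R, 3 * m%:R <= 4 * n%:R + 3 :> R &
  gnp_prob p (fun E : {set 'I_N * 'I_N} => ~~ ((ex_path n E)%:R <= c * N%:R)) <=
  expR ((x - 1) * p * (n%:R * (5 / 3 * m%:R + 1)) - ln x * (c * (m%:R - 1))
        + 2 * (m%:R + n%:R) * ln (N%:R / n%:R))].
Proof.
move=> n3 nN p01 x1 c0; have := block_size n3 nN.
set k := (N %/ n)%N; set m := (N %/ k).+1.
move=> [k3 kn Nkm kmN [nm m4 mN N4]]; exists m.
have nmR : n%:R + 1 <= m%:R :> R by rewrite natr1 ler_nat.
have m4R : 3 * m%:R <= 4 * n%:R + 3 :> R by rewrite -!(natrM, natrD) ler_nat.
have n3R : 3 <= n%:R :> R by rewrite ler_nat.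
split => //.
have n0 : (0 < n)%N by lia.
have nN2 : (n <= N)%N by lia.
have k0 : (0 < k)%N by lia.
have nN' : (0 < n <= N)%N by rewrite n0.
have mN' : (0 < m <= N)%N by lia.
apply: le_trans (ex_path_upper_tail p01 _ nN' mN' Nkm x1) _.
have L1 := ln_ratio_ge1 n0 nN.
set L := ln _ in L1 *.
have hb : ('C(N, m) * 'C(N, n))%:R <= expR (2 * (m%:R + n%:R) * L) :> R.
  rewrite natrM (_ : _ * L = m%:R * (2 * L) + n%:R * (2 * L)); last by ring.
  rewrite expRD ler_pM ?ler0n //.
    apply: le_trans (bin_le_expR R (n := n) _ nN2) _; first by rewrite n0 ltnW.
    by rewrite ler_expR ler_wpM2l ?ler0n // -/L; lra.
  apply: le_trans (bin_le_expR R (n := n) _ nN2) _; first by rewrite n0 leqnn.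
  by rewrite ler_expR ler_wpM2l ?ler0n // -/L; lra.
rewrite [leRHS]expRD mulrC; apply: ler_pM; rewrite ?expR_ge0 ?ler0n //.
rewrite ler_expR; apply: lerB.
  apply: ler_wpM2l; first by case/andP: p01 => p0 _; rewrite mulr_ge0 // subr_ge0.
  nra.
apply: ler_wpM2l; first exact: ln_ge0.
rewrite -mulrA; apply: ler_wpM2l => //.
rewrite ler_pdivlMr ?ltr0n //.
have : (k * m.-1)%:R <= N%:R :> R by rewrite ler_nat.
by rewrite natrM /m /= -[(N %/ k).+1]addn1 natrD; lra.
Qed.

Lemma ex_path_upper_dense (N n : nat) (p : R) :
  (300 <= n)%N -> (3 * n <= N)%N -> 0 < p <= 1 ->
  ln (N%:R / n%:R) / (6 * n%:R) <= p ->
  gnp_prob p (fun E : {set 'I_N * 'I_N} =>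
     ~~ ((ex_path n E)%:R <= 18 * p * n%:R * N%:R)) <= expR (- (n%:R / 36)).
Proof.
move=> n300 nN /andP[p0 p1] hp.
have nR : 300 <= n%:R :> R by rewrite ler_nat.
have n3 : (3 <= n)%N by lia.
have p01 : 0 <= p <= 1 by rewrite ltW.
have [||m [nm m4 h]] := ex_path_upper n3 nN p01 (x := 8) (c := 18 * p * n%:R).
- by lra.
- by rewrite mulr_ge0 // mulr_ge0 // ltW.
apply: le_trans h _; rewrite ler_expR.
have n0 : (0 < n)%N by lia.
have L1 := ln_ratio_ge1 n0 nN.
move: hp; set L := ln _ in L1 *; rewrite ler_pdivrMr; last by lra.
move=> hL; set q := p * n%:R.
have hq : L <= 6 * q by rewrite /q; lra.
have hq6 : 1 <= 6 * q by lra.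
have -> : (8 - 1) * p * (n%:R * (5 / 3 * m%:R + 1)) = 7 * q * (5 / 3 * m%:R + 1).
  by rewrite /q; ring.
have -> : 18 * p * n%:R * (m%:R - 1) = 18 * q * (m%:R - 1) by rewrite /q; ring.
have l8 := ln8_ge2.
have h1 : 2 * (18 * q * (m%:R - 1)) <= ln 8 * (18 * q * (m%:R - 1)).
  by apply: ler_wpM2r => //; apply: mulr_ge0; lra.
have h2 : 2 * (m%:R + n%:R) * L <= 2 * (m%:R + n%:R) * (6 * q).
  by apply: ler_wpM2l => //; lra.
(* With [ln 8 >= 2] and [L <= 6 q] the exponent is at most [- q (37 m / 3 - 12 n - 43)]; as
   [m >= n + 1], the bracket is at least [n / 6] for [n >= 300]. *)
have h3 : q * (n%:R / 6) <= q * (37 / 3 * m%:R - 12 * n%:R - 43).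
  by apply: ler_wpM2l; lra.
have h4 : 6^-1 * (n%:R / 6) <= q * (n%:R / 6) by apply: ler_wpM2r; lra.
lra.
Qed.

Lemma ex_path_upper_sparse (N n : nat) (p : R) :
  let w := ln (N%:R / n%:R) / (n%:R * p) in
  (300 <= n)%N -> (3 * n <= N)%N -> 0 < p <= 1 ->
  p <= ln (N%:R / n%:R) / (6 * n%:R) ->
  gnp_prob p (fun E : {set 'I_N * 'I_N} =>
     ~~ ((ex_path n E)%:R <= 8 * (w / ln w) * p * n%:R * N%:R)) <= expR (- n%:R).
Proof.
move=> w n300 nN /andP[p0 p1] hp.
have nR : 300 <= n%:R :> R by rewrite ler_nat.
have n0 : (0 < n)%N by lia.
have L1 := ln_ratio_ge1 n0 nN.
move: hp; rewrite /w; set L := ln (N%:R / n%:R) in L1 *; rewrite -/L => hp {w}.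
set w := L / (n%:R * p).
have np0 : 0 < n%:R * p by rewrite mulr_gt0 //; lra.
have w6 : 6 <= w.
  by move: hp; rewrite /w !ler_pdivlMr; [lra|lra|lra].
have wE : w * p * n%:R = L by rewrite /w; field; lra.
have lw : 3 / 2 <= ln w.
  by apply: le_trans ln6_ge _; rewrite ler_ln // posrE; lra.
pose c := 8 * (w / ln w) * p * n%:R.
(* The choice [x = w] cancels the logarithm in the target: the main term becomes [8 L (m - 1)],
   against [L (5 m / 3 + 1)] from the moment and [2 (m + n) L] from the binomials. *)
have cE : ln w * c = 8 * L by rewrite /c -wE; field; lra.
have c0 : 0 <= c.
  have wl0 : 0 <= w / ln w by apply: divr_ge0; [exact: le_trans w6|lra].
  by rewrite /c mulr_ge0 // mulr_ge0 ?(ltW p0) // mulr_ge0.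
have n3 : (3 <= n)%N by lia.
have p01 : 0 <= p <= 1 by rewrite ltW.
have [|m [nm m4 h]] := ex_path_upper n3 nN p01 (x := w) _ c0.
  by apply: le_trans w6; lra.
apply: le_trans h _; rewrite ler_expR -/L mulrA cE.
have h1 : (w - 1) * p * (n%:R * (5 / 3 * m%:R + 1)) <= L * (5 / 3 * m%:R + 1).
  rewrite mulrA; apply: ler_wpM2r; first by lra.
  by rewrite -wE; nra.
have h2 : 1 * n%:R <= L * (13 / 3 * m%:R - 2 * n%:R - 9).
  by apply: ler_pM; lra.
lra.
Qed.

End Numerics.

(** * Lower bound in the dense range *)

Section BlockGraph.
Local Open Scope nat_scope.

(** A label preserved by every edge is constant along a path; it will confine paths to one block, or
    to one component of the star forest. *)
Lemma path_const N k F (f : {ffun 'I_k.+1 -> 'I_N}) (U : Type) (c : 'I_N -> U) :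
  (forall u v, adj F u v -> c u = c v) ->
  [forall i : 'I_k, adj F (f (widen_ord (leqnSn k) i)) (f (lift ord0 i))] ->
  forall i, c (f i) = c (f ord0).
Proof.
move=> cF /forallP fF [i]; elim: i => [|i IH] ik.
  by congr (c (f _)); apply: val_inj.
have ik' : i < k by [].
rewrite -(IH (ltnW ik)); have := cF _ _ (fF (Ordinal ik')) => e.
rewrite (_ : Ordinal ik = lift ord0 (Ordinal ik')); last exact: val_inj.
by rewrite -e; congr (c (f _)); apply: val_inj.
Qed.

Lemma card_pairs n : #|pairs n| = 'C(n, 2).
Proof.
rewrite -bin2_sum big_mkord -sum1_card.
rewrite (eq_bigl (fun q : 'I_n * 'I_n => true && (q.1 < q.2))); last first.
  by move=> q; rewrite inE.
rewrite -(pair_big_dep xpredT (fun i j : 'I_n => i < j) (fun _ _ => 1)) /=.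
rewrite (exchange_big_dep xpredT) //=; apply: eq_bigr => v _.
by rewrite -(big_ord_widen n (fun=> 1) (ltnW (ltn_ord v))) sum1_card card_ord.
Qed.

Definition block_pairs (N n : nat) : {set 'I_N * 'I_N} :=
  [set e in pairs N | e.1 %/ n == e.2 %/ n].

Lemma card_block_pairs N n k : k * n <= N ->
  k * 'C(n, 2) <= #|block_pairs N n|.
Proof.
move=> knN.
have lt (j : 'I_k) (a : 'I_n) : j * n + a < N.
  apply: leq_trans knN; have := ltn_ord j; have := ltn_ord a; nia.
pose g (q : 'I_k * ('I_n * 'I_n)) := (Ordinal (lt q.1 q.2.1), Ordinal (lt q.1 q.2.2)).
have dv (j : 'I_k) (a : 'I_n) : (j * n + a) %/ n = j.
  have n0 : 0 < n := leq_ltn_trans (leq0n _) (ltn_ord a).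
  by rewrite divnMDl // divn_small // addn0.
have g_inj : injective g.
  move=> [j [a b]] [j' [a' b']] [/= ea eb].
  have jj : j = j' by apply: val_inj; rewrite /= -(dv j a) ea dv.
  subst j'; congr (_, (_, _)); apply: val_inj.
    by apply/eqP; rewrite -(eqn_add2l (j * n)) ea.
  by apply/eqP; rewrite -(eqn_add2l (j * n)) eb.
rewrite -card_pairs -{1}(card_ord k) -cardsT -cardsX -(card_imset _ g_inj).
apply: subset_leq_card; apply/subsetP => _ /imsetP[[j [a b]] jab ->].
by move: jab; rewrite !inE /= !dv ltn_add2l eqxx andbT.
Qed.

(** A path stays in one block, where vertices are determined by their residue mod [n], so it cannot
    have [n + 1] distinct vertices. *)
Lemma block_pairs_path_free N n (F : {set 'I_N * 'I_N}) :
  0 < n -> F \subset block_pairs N n -> ~~ has_path n F.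
Proof.
move=> n0 /subsetP sF; apply/existsP => -[f /andP[/injectiveP f_inj pf]].
have cF u v : adj F u v -> u %/ n = v %/ n.
  by rewrite /adj => /orP[] /sF; rewrite !inE /= => /andP[_ /eqP].
have cst := path_const (c := fun u : 'I_N => u %/ n) cF pf.
pose h (i : 'I_n.+1) : 'I_n := Ordinal (ltn_pmod (f i) n0).
have h_inj : injective h.
  move=> i j /(congr1 val) /= e; apply: f_inj; apply: val_inj.
  by rewrite /= (divn_eq (f i) n) (divn_eq (f j) n) !cst e.
by have := leq_card h h_inj; rewrite !card_ord ltnn.
Qed.

End BlockGraph.

Lemma ex_path_lower_dense (R : realType) (N n : nat) (p : R) :
  (300 <= n)%N -> (3 * n <= N)%N -> 0 < p <= 1 ->
  ln (N%:R / n%:R) / (6 * n%:R) <= p ->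
  gnp_prob p (fun E : {set 'I_N * 'I_N} =>
     ~~ (4^-1 * p * n%:R * N%:R <= (ex_path n E)%:R)) <= expR (- (n%:R / 320)).
Proof.
move=> n300 nN /andP[p0 p1] hp.
have n0 : (0 < n)%N by lia.
have L1 := ln_ratio_ge1 R n0 nN.
have nR : 300 <= n%:R :> R by rewrite ler_nat.
have NR : 3 * n%:R <= N%:R :> R by rewrite -natrM ler_nat.
have [|k3 kn _ _ [_ _ _ N4]] := @block_size N n _ nN; first by lia.
set k := (N %/ n)%N in k3 kn N4.
have p01 : 0 <= p <= 1 by lra.
have sS : block_pairs N n \subset pairs N.
  by apply/subsetP => q; rewrite inE => /andP[].
apply: (@le_trans _ _ (gnp_prob p (fun E : {set 'I_N * 'I_N} =>
    #|E :&: block_pairs N n|%:R < 4^-1 * p * n%:R * N%:R))).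
  rewrite !gnp_probE; apply: expect_le => // E _.
  rewrite -ltNge ler_nat; case: ltP => // h; case: ltP => //.
  move/(lt_le_trans h); rewrite ltr_nat ltnNge ex_path_ge ?subsetIl //.
  exact: block_pairs_path_free (subsetIr _ _).
apply: le_trans (gnp_prob_card_lt p01 (s := 1 / 4) _ sS _) _; first by lra.
have pn : 1 <= 6 * (p * n%:R) by move: hp; rewrite ler_pdivrMr; lra.
rewrite ler_expR.
have he : expR (- (1 / 4)) <= 4 / 5 :> R.
  rewrite expRN (_ : 4 / 5 = (5 / 4)^-1); last by field.
  rewrite lef_pV2 ?posrE ?expR_gt0 //; last by lra.
  by apply: le_trans (expR_ge1Dx _); lra.
(* [k * 'C(n, 2)] with [k n >= 3 N / 4]. The mean is about 3/8 of [p n N], against the target 1/4;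
   the Chernoff parameter 1/4 leaves [1/16 - 3/40 = - 1/80] in the exponent. *)
have cS : N%:R * (n%:R - 1) * (3 / 8) <= #|block_pairs N n|%:R :> R.
  have e2 : ('C(n, 2) * 2 = n * n.-1)%N.
    by have := bin_ffact n 2; rewrite ffactnS ffactn1.
  have h1 : (3 * (N * n.-1) <= 8 * #|block_pairs N n|)%N.
    have := leq_trans (leq_mul (leqnn 2) (card_block_pairs kn)) (leqnn _).
    rewrite mulnCA [(2 * 'C(n, 2))%N]mulnC e2 => h.
    have := leq_mul (leqnn 4) h; have := leq_mul N4 (leqnn n.-1).
    by rewrite -!mulnA [(4 * (2 * _))%N]mulnA; apply: leq_trans.
  have nE : n%:R - 1 = n.-1%:R :> R by rewrite -[in LHS](prednK n0) -natr1 addrK.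
  move: h1; rewrite nE -(ler_nat R) !natrM; lra.
have pN : 2^-1 <= p * N%:R by nra.
have Z0 : 0 <= p * (N%:R * (n%:R - 1) * (3 / 8)).
  by rewrite mulr_ge0 ?mulr_ge0 ?ler0n //; lra.
have h2 : 5^-1 * (p * (N%:R * (n%:R - 1) * (3 / 8))) <=
    (1 - expR (- (1 / 4))) * (p * #|block_pairs N n|%:R).
  by apply: ler_pM; [lra | exact: Z0 | lra | rewrite ler_wpM2l // ltW].
have h3 : 2^-1 * (n%:R / 80 - 3 / 40) <= p * N%:R * (n%:R / 80 - 3 / 40).
  by apply: ler_wpM2r => //; lra.
rewrite -[_ * p * _]mulrA; lra.
Qed.

(** * Lower bound in the sparse range *)

Section StarForest.
Local Open Scope nat_scope.
Variables (N b k : nat).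
Hypotheses (b_gt0 : 0 < b) (kb_le : k * b <= N).
Implicit Types (v : 'I_N) (E : {set 'I_N * 'I_N}).

(* The first [k * b] vertices are split into [k] centre blocks of size [b];
   [star v i] collects the pairs joining [v] to the [i]-th block. *)
Definition star v (i : nat) : {set 'I_N * 'I_N} :=
  [set e : 'I_N * 'I_N | (e.2 == v) && (e.1 %/ b == i)].

(** Centre vertices precede the outer ones, so an edge between the two kinds has its outer end as
    second coordinate. *)
Definition outer : {set 'I_N} := [set v : 'I_N | k * b <= v].

Lemma card_star v (i : 'I_k) : #|star v i| = b.
Proof.
have lt (a : 'I_b) : i * b + a < N.
  by apply: leq_trans kb_le; have := ltn_ord a; have := ltn_ord i; nia.
pose g a := (Ordinal (lt a), v).
have g_inj : injective g.
  by move=> a a' [e]; apply: val_inj; apply/eqP; rewrite -(eqn_add2l (i * b)) e.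
rewrite -[RHS]card_ord -cardsT -(card_imset _ g_inj); congr #|pred_of_set _|.
apply/setP => -[u w]; rewrite !inE /=; apply/andP/imsetP.
  move=> [/eqP -> /eqP ui]; exists (Ordinal (ltn_pmod u b_gt0)) => //.
  by congr (_, _); apply: val_inj; rewrite /= -ui -divn_eq.
by move=> [a _ [-> ->]]; rewrite /= divnMDl // divn_small // addn0 !eqxx.
Qed.

Lemma card_outer : N - k * b <= #|outer|.
Proof.
rewrite leq_subLR -[leqLHS](card_ord N) -(cardsC outer) addnC leq_add2r.
rewrite -[leqRHS]card_ord.
have [/eqP kb0|kb0] := posnP (k * b).
  rewrite (_ : ~: outer = set0) ?cards0 //; apply/setP => u.
  by rewrite !inE (eqP kb0).
pose f (u : 'I_N) : 'I_(k * b) := Ordinal (ltn_pmod u kb0).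
rewrite -(card_in_imset (f := f) (D := ~: outer)); first exact: max_card.
move=> u w; rewrite !inE -!ltnNge => ul wl /(congr1 val) /=.
by rewrite !modn_small // => /val_inj.
Qed.

Definition rich d v E := [exists i : 'I_k, d <= #|E :&: star v i|].

(** Each rich outer vertex keeps only its edges to one chosen centre block. Every edge then contains
    a centre, so a path with [n + 1 >= 2 b + 2] vertices would need [b + 1] centres from a single
    block of size [b]. *)
Lemma star_forest d n E : 2 * b < n ->
  d * #|[set v in outer | rich d v E]| <= ex_path n E.
Proof.
move=> bn; set G := [set v in outer | rich d v E].
(* The default value [k] is the index of no centre block. *)
pose c v : nat := if [pick i : 'I_k | d <= #|E :&: star v i|] is Some i then i else k.
have cG v : v \in G -> c v < k /\ d <= #|E :&: star v (c v)|.
  rewrite inE /c => /andP[_ /existsP[i hi]]; case: pickP => [j hj|/(_ i)].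
    by split.
  by rewrite hi.
pose F := [set e in E | (e.2 \in G) && (e.1 %/ b == c e.2)].
have sFE : F \subset E by apply/subsetP => q; rewrite inE => /andP[].
apply: leq_trans (_ : #|F| <= _).
  rewrite -[#|F|]sum1_card (partition_big (fun e => e.2) (mem G)) /=; last first.
    by move=> q; rewrite inE => /andP[_ /andP[]].
  rewrite mulnC -sum_nat_const; apply: leq_sum => v vG.
  have [_ dv] := cG v vG; apply: leq_trans dv _; rewrite sum1dep_card.
  apply: subset_leq_card; apply/subsetP => -[u w]; rewrite !inE /=.
  by move=> /andP[-> /andP[/eqP -> ->]]; move: vG; rewrite !inE => ->; rewrite eqxx.
apply: ex_path_ge => //.
have FP u v : (u, v) \in F -> [/\ u < k * b, k * b <= v & u %/ b = c v].
  rewrite inE /= => /andP[_ /andP[vG /eqP uv]]; have [ck _] := cG v vG.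
  by split=> //; [rewrite -ltn_divLR // uv | move: vG; rewrite !inE => /andP[]].
pose comp (u : 'I_N) := if u < k * b then u %/ b else c u.
have compF u v : adj F u v -> comp u = comp v.
  rewrite /adj /comp => /orP[] /FP[-> h2 e]; rewrite ltnNge h2 /=; by rewrite e.
have lowF u v : adj F u v -> (u < k * b) || (v < k * b).
  by rewrite /adj => /orP[] /FP[-> _ _]; rewrite ?orbT.
apply/existsP => -[f /andP[/injectiveP f_inj pf]].
have cst := path_const compF pf.
(* The positions [2 j] and [2 j + 1] for [j <= b] form disjoint consecutive pairs on the path; [a j]
   selects a centre in each. *)
have lt0 (j : 'I_b.+1) : 2 * j < n by have := ltn_ord j; lia.
have lt1 (j : 'I_b.+1) : (2 * j).+1 < n.+1 by have := lt0 j; lia.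
pose a0 j : 'I_n.+1 := Ordinal (ltnW (lt1 j)).
pose a1 j : 'I_n.+1 := Ordinal (lt1 j).
pose a j := if f (a0 j) < k * b then a0 j else a1 j.
have aE j : a j = (2 * j + odd (a j))%N :> nat.
  by rewrite /a; case: ifP => _; rewrite /= oddM ?addn0 ?addn1.
have low j : f (a j) < k * b.
  rewrite /a; case: ifP => // h; move/forallP: pf => /(_ (Ordinal (lt0 j))) /lowF.
  rewrite (_ : widen_ord _ _ = a0 j); last exact: val_inj.
  by rewrite (_ : lift _ _ = a1 j) ?h //; apply: val_inj.
pose h j : 'I_b := Ordinal (ltn_pmod (f (a j)) b_gt0).
have h_inj : injective h.
  move=> i j /(congr1 val) /= e.
  have : f (a i) = f (a j).
    apply: val_inj; rewrite /= (divn_eq (f (a i)) b) (divn_eq (f (a j)) b) e.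
    by have := cst (a i); have := cst (a j); rewrite /comp !low => -> ->.
  move=> /f_inj /(congr1 val) /= eij; apply: val_inj => /=.
  by have := aE i; have := aE j; rewrite eij; lia.
by have := leq_card h h_inj; rewrite !card_ord ltnn.
Qed.

End StarForest.

(** * Tail bound for the number of attached vertices *)

Section StarProbability.
Variables (R : realType) (N b k : nat) (p : R).
Hypotheses (b_gt0 : (0 < b)%N) (kb_le : (k * b <= N)%N) (p01 : 0 <= p <= 1).

Lemma prod_bool (I : finType) (P : pred I) :
  \prod_i (P i)%:R = [forall i, P i]%:R :> R.
Proof.
case: (boolP [forall i, P i]) => [/forallP h|].
  by apply: big1 => i _; rewrite h.
rewrite negb_forall => /existsP[i hi].
by rewrite (bigD1 i) //= (negbTE hi) mul0r.
Qed.

(** The [k] stars of [v] are disjoint, so their failures are independent and the bounds [expR (- y)]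
    multiply. *)
Lemma expect_not_rich d (y : R) (v : 'I_N) :
  (forall S : {set 'I_N * 'I_N}, #|S| = b ->
     expect p S (fun E => (#|E| < d)%N%:R) <= expR (- y)) ->
  expect p [set e : 'I_N * 'I_N | (e.2 == v) && (e.1 %/ b < k)%N]
    (fun E => (~~ rich b k d v E)%:R) <= expR (- (k%:R * y)).
Proof.
move=> hy; set D := [set e | _].
have -> : expect p D (fun E => (~~ rich b k d v E)%:R) =
    expect p D (fun E => \prod_(i <- index_enum 'I_k)
       (fun E' : {set 'I_N * 'I_N} => (#|E'| < d)%N%:R) (E :&: star b v i)).
  apply: eq_expect => E _; rewrite prod_bool /rich negb_exists.
  by congr (nat_of_bool _)%:R; apply: eq_forallb => i; rewrite ltnNge.
rewrite (expect_prod p (S := fun i : 'I_k => star b v i)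
  (fun (i : 'I_k) (E' : {set 'I_N * 'I_N}) => (#|E'| < d)%N%:R)); first last.
- move=> i j _ _ ij; rewrite -setI_eq0; apply/eqP/setP => q; rewrite !inE.
  apply/negP => /andP[/andP[_ /eqP qi] /andP[_ /eqP qj]].
  by case/eqP: ij; apply: val_inj; rewrite /= -qi -qj.
- move=> i _; apply/subsetP => q; rewrite !inE => /andP[-> /eqP ->] /=.
  exact: ltn_ord.
- exact: index_enum_uniq.
apply: le_trans (_ : \prod_(i : 'I_k) expR (- y) <= _).
  apply: ler_prod => i _; rewrite expect_ge0 //= hy //.
  exact: card_star.
by rewrite prodr_const card_ord -expRM_natl mulrN.
Qed.

(** Each outer vertex fails to be rich with probability at most [expR (- 1 / 3) <= 3 / 4],
    independently. A Chernoff bound at [s = 1 / 20] for the number of failures exceeding [5 / 6] of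
    the outer vertices leaves the rate [1/24 - 3/76 = 1/456]. *)
Lemma star_forest_tail d n (y : R) : (2 * b < n)%N ->
  (forall S : {set 'I_N * 'I_N}, #|S| = b ->
     expect p S (fun E => (#|E| < d)%N%:R) <= expR (- y)) ->
  1 <= 3 * (k%:R * y) ->
  gnp_prob p (fun E : {set 'I_N * 'I_N} =>
     ~~ (d%:R * #|outer N b k|%:R / 6 <= (ex_path n E)%:R :> R)) <=
  expR (- (#|outer N b k|%:R / 500)).
Proof.
move=> bn hy ky; set V := outer N b k; pose s : R := 1 / 20; pose x := expR s.
have s0 : 0 <= s by rewrite /s; lra.
pose D (v : 'I_N) := [set e : 'I_N * 'I_N | (e.2 == v) && (e.1 %/ b < k)%N].
(* This is [x] raised to the indicator of failure, written affinely so that its expectation is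
   immediate. *)
pose g v (E : {set 'I_N * 'I_N}) := 1 + (x - 1) * (~~ rich b k d v E)%:R.
have x1 : 1 <= x by apply: le_trans (expR_ge1Dx _); lra.
have richD v E : rich b k d v (E :&: D v) = rich b k d v E.
  apply: eq_existsb => i; rewrite -setIA.
  have /setIidPr -> // : star b v i \subset D v.
  by apply/subsetP => q; rewrite !inE => /andP[-> /eqP ->] /=; apply: ltn_ord.
pose G E := \prod_(v <- enum V) g v (E :&: D v).
have GE E : G E = x ^+ (#|V| - #|[set v in V | rich b k d v E]|).
  rewrite /G big_enum /= (eq_bigr (fun v => x ^+ (~~ rich b k d v E))); last first.
    move=> v _; rewrite /g richD; case: (rich _ _ _ _ _) => /=;
    by rewrite ?mulr0 ?mulr1; ring.
  rewrite -expr_sum; congr (_ ^+ _).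
  rewrite -sum1_card (bigID (rich b k d ^~ E)) /=.
  rewrite [X in (_ = X - _)%N](bigID (rich b k d ^~ E)) /=.
  rewrite big1 ?add0n; last by move=> v /andP[_ ->].
  rewrite -[#|[set v in V | _]|]sum1dep_card addKn.
  by apply: eq_bigr => v /andP[_ ->].
have sub (E : {set 'I_N * 'I_N}) :
    (#|[set v in V | rich b k d v E]| <= #|V|)%N.
  by apply: subset_leq_card; apply/subsetP => v; rewrite inE => /andP[].
apply: (@le_trans _ _
  (expect p (pairs N) (fun E => expR (- (s * (5 / 6 * #|V|%:R))) * G E))).
  apply: gnp_prob_le_expect => // [E|E _].
    by rewrite mulr_ge0 ?expR_ge0 // GE exprn_ge0 ?expR_ge0.
  rewrite -ltNge GE -expRM_natr -expRD => hex.
  apply: le_trans (expR_ge1Dx _); rewrite lerDl addrC -mulrBr mulr_ge0 //.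
  rewrite natrB //.
  have := star_forest b_gt0 kb_le d E bn; rewrite -(ler_nat R) natrM -/V => h.
  have {hex h} hlt := le_lt_trans h hex.
  suff : #|[set v in V | rich b k d v E]|%:R <= #|V|%:R / 6 :> R by lra.
  have [d0|d0] := posnP d; first by move: hlt; rewrite d0 !mul0r ltxx.
  have d0R : 0 < d%:R :> R by rewrite ltr0n.
  by rewrite -(ler_pM2l d0R) mulrA ltW.
rewrite expectZ (expect_prod p (S := D) g); first last.
- move=> v w _ _ vw; rewrite -setI_eq0; apply/eqP/setP => q; rewrite !inE.
  by apply/negP => /andP[/andP[/eqP ev _] /andP[/eqP ew _]]; rewrite -ev ew eqxx in vw.
- move=> v; rewrite mem_enum => vV; apply/subsetP => q; rewrite !inE.
  move=> /andP[/eqP -> qk]; move: vV; rewrite inE; apply: leq_trans.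
  by rewrite -ltn_divLR.
- exact: enum_uniq.
have e34 : expR (- (k%:R * y)) <= 3 / 4.
  rewrite expRN (_ : 3 / 4 = (4 / 3)^-1); last by field.
  rewrite lef_pV2 ?posrE ?expR_gt0 //; last by lra.
  by apply: le_trans (expR_ge1Dx _); lra.
have gle v : 0 <= expect p (D v) (g v) <= expR ((x - 1) * (3 / 4)).
  rewrite expectD expect1 expectZ.
  have q0 : 0 <= expect p (D v) (fun E => (~~ rich b k d v E)%:R).
    exact: expect_ge0.
  have := expect_not_rich v hy; rewrite -/(D v) => hv.
  rewrite addr_ge0 ?mulr_ge0 //=; last lra.
  apply: le_trans (expR_ge1Dx _); rewrite lerD2l; apply: ler_wpM2l; lra.
apply: le_trans (_ : expR (- (s * (5 / 6 * #|V|%:R))) *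
    \prod_(v <- enum V) expR ((x - 1) * (3 / 4)) <= _).
  by apply: ler_wpM2l; rewrite ?expR_ge0 //; apply: ler_prod.
rewrite big_enum prodr_const -expRM_natr -expRD ler_expR.
have hx : x <= 20 / 19.
  rewrite /x -[expR s]invrK -expRN (_ : 20 / 19 = (19 / 20)^-1); last by field.
  rewrite lef_pV2 ?posrE ?expR_gt0 //; last by lra.
  by apply: le_trans (expR_ge1Dx _); rewrite /s; lra.
have V0 : 0 <= #|V|%:R :> R by [].
have : (x - 1) * (3 / 4) * #|V|%:R <= 1 / 19 * (3 / 4) * #|V|%:R.
  by apply: ler_wpM2r => //; lra.
rewrite /s; lra.
Qed.

End StarProbability.

(** Induction through [(d + 1) C(b + 1, d + 1) = (b + 1) C(b, d)], with [(b + 1) d <= (d + 1) b] for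
    [d <= b]. *)
Lemma expn_le_bin (b d : nat) : (d <= b)%N -> (b ^ d <= 'C(b, d) * d ^ d)%N.
Proof.
elim: d b => [|d IH] [|b] //.
rewrite ltnS => db; have [b0|b0] := posnP b.
  by move: db; rewrite b0 leqn0 => /eqP ->.
have h : (d.+1 * 'C(b.+1, d.+1) = b.+1 * 'C(b, d))%N by rewrite -mul_bin_diag.
rewrite [(d.+1 ^ _)%N]expnS mulnA [('C(_, _) * _)%N]mulnC h expnS -mulnA.
rewrite leq_mul2l -(leq_pmul2r (_ : 0 < b ^ d)%N) ?expn_gt0 ?b0 //.
have h1 : (b.+1 ^ d * b ^ d <= b.+1 ^ d * ('C(b, d) * d ^ d))%N.
  by rewrite leq_mul2l IH ?orbT.
have h2 : ((b.+1 * d) ^ d <= (d.+1 * b) ^ d)%N.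
  by case: (d) db => // d' db; rewrite leq_exp2r //; lia.
rewrite !expnMn in h2.
by apply: leq_trans h1 _; rewrite mulnCA -mulnA leq_mul2l h2 orbT.
Qed.

(** [2 b < n] is what [star_forest] needs, and it also leaves at least half of the vertices outside
    the centres. *)
Lemma centre_size (N n k : nat) : (3 <= n)%N -> (k * n <= N)%N ->
  let b := (n.-1)./2 in
  [/\ (n <= 2 * b + 2)%N, (2 * b < n)%N, (0 < b)%N, (k * b <= N)%N &
      (N <= 2 * (N - k * b))%N].
Proof.
move=> n3 kn b.
have b1 : (n <= 2 * b + 2)%N by rewrite /b; lia.
have b2 : (2 * b < n)%N by rewrite /b; lia.
have kb : (2 * (k * b) <= N)%N.
  by apply: leq_trans kn; rewrite mulnCA leq_mul2l (ltnW b2) orbT.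
by split; lia.
Qed.

(** * Choice of the degree and the sparse lower tail *)

Section SparseLower.
Variable R : realType.

(** Only the event [#|E| = d] is removed from the total mass 1, followed by
    [1 - t <= expR (- t)]. *)
Lemma expect_card_lt (T : finType) (p : R) (S : {set T}) d : 0 <= p <= 1 ->
  expect p S (fun E => (#|E| < d)%N%:R) <=
  expR (- ('C(#|S|, d)%:R * p ^+ d * (1 - p) ^+ (#|S| - d))).
Proof.
move=> p01; apply: le_trans (expR_ge1Dx _).
have /andP[p0 p1] := p01.
rewrite lerBrDr -[leRHS](expect1 p S).
have -> : expect p S (fun=> 1) = expect p S (fun E => (#|E| < d)%N%:R) +
    expect p S (fun E => (d <= #|E|)%N%:R).
  rewrite -expectD; apply: eq_expect => E _.
  by rewrite ltnNge; case: (d <= #|E|)%N => /=; ring.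
rewrite lerD2l /expect -cards_draws -sumr_const -mulrA mulr_suml.
rewrite big_mkcond [leRHS]big_mkcond /=; apply: ler_sum => E _.
rewrite inE; case sE: (E \subset S) => //=; case: eqP => [->|_].
  by rewrite leqnn mulr1 mul1r.
by rewrite !mulr_ge0 ?exprn_ge0 //; lra.
Qed.

(** [C(b, d) p ^ d] is at least [(b p / d) ^ d >= w ^ (- d)], and [1 / (1 - p) <= 1 + 3 p / 2] for
    [p <= 1 / 3] handles the other factor. *)
Lemma binomial_point_lower (b d : nat) (p w : R) :
  (0 < d <= b)%N -> 0 <= p <= 1 / 3 -> 0 < w -> d%:R <= w * (b%:R * p) ->
  expR (- (d%:R * ln w) - 3 / 2 * (p * b%:R)) <=
  'C(b, d)%:R * p ^+ d * (1 - p) ^+ (b - d).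
Proof.
move=> /andP[d0 db] /andP[p0 p1] w0 hw.
have d0R : 0 < d%:R :> R by rewrite ltr0n.
rewrite expRD; apply: ler_pM; rewrite ?expR_ge0 //.
  rewrite -mulrN -lnV ?posrE // expRM_natl lnK ?posrE ?invr_gt0 //.
  apply: le_trans (_ : (b%:R * p / d%:R) ^+ d <= _).
    rewrite lerXn2r ?nnegrE ?invr_ge0 ?(ltW w0) //.
      by rewrite divr_ge0 ?mulr_ge0 ?ler0n // ltW.
    by rewrite ler_pdivlMr // mulrC ler_pdivrMr // mulrC.
  rewrite expr_div_n exprMn ler_pdivrMr ?exprn_gt0 // mulrAC.
  rewrite ler_wpM2r ?exprn_ge0 //.
  by rewrite -!natrX -natrM ler_nat expn_le_bin.
apply: le_trans (_ : (1 - p) ^+ b <= _).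
  rewrite mulrA -mulNr expRM_natr lerXn2r ?nnegrE ?expR_ge0 //; first by lra.
  rewrite expRN -[1 - p]invrK lef_pV2 ?posrE ?expR_gt0 ?invr_gt0; [|lra|lra].
  apply: le_trans (expR_ge1Dx _).
  rewrite -[_^-1]mul1r ler_pdivrMr; last by lra.
  by nra.
by apply: ler_wiXn2l; [lra|lra|exact: leq_subr].
Qed.

Lemma ex_path_lower_sparse (N n : nat) (p : R) :
  let w := ln (N%:R / n%:R) / (n%:R * p) in
  (300 <= n)%N -> (3 * n <= N)%N -> N%:R <= n%:R * expR (2 * n%:R) :> R ->
  0 < p <= 1 -> N%:R^-1 <= p -> p <= ln (N%:R / n%:R) / (6 * n%:R) ->
  gnp_prob p (fun E : {set 'I_N * 'I_N} =>
     ~~ (75^-1 * (w / ln w) * p * n%:R * N%:R <= (ex_path n E)%:R)) <=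
  expR (- (n%:R / 1000)).
Proof.
move=> w n300 nN Nub /andP[p0 p1] pN hp.
have nR : 300 <= n%:R :> R by rewrite ler_nat.
have NR : 3 * n%:R <= N%:R :> R by rewrite -natrM ler_nat.
have n3 : (3 <= n)%N := leq_trans (isT : 3 <= 300)%N n300.
have n0 : (0 < n)%N := leq_trans (isT : 0 < 3)%N n3.
have N0 : (0 < N)%N by lia.
have n0R : 0 < n%:R :> R by lra.
have N0R : 0 < N%:R :> R by lra.
have L1 := ln_ratio_ge1 R n0 nN.
have expL : n%:R * expR (ln (N%:R / n%:R)) = N%:R :> R.
  by rewrite lnK ?posrE ?divr_gt0 // mulrC divfK ?gt_eqF.
have L2 : ln (N%:R / n%:R) <= 2 * n%:R :> R.
  rewrite -[leRHS]expRK ler_ln ?posrE ?expR_gt0 ?divr_gt0 //.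
  by rewrite ler_pdivrMr // mulrC.
move: hp; rewrite /w; set L := ln (N%:R / n%:R) in L1 L2 expL *; rewrite -/L => hp {w}.
set w := L / (n%:R * p).
have np0 : 0 < n%:R * p by rewrite mulr_gt0.
have hp6 : p * (6 * n%:R) <= L by move: hp; rewrite ler_pdivlMr //; lra.
have w6 : 6 <= w by rewrite /w ler_pdivlMr //; lra.
have wE : w * p * n%:R = L by rewrite /w; field; lra.
have lw : 3 / 2 <= ln w.
  by apply: le_trans (ln6_ge R) _; rewrite ler_ln // posrE; lra.
set x := L / ln w.
have xE : x * ln w = L by rewrite /x; field; lra.
have x0 : 0 < x by rewrite /x divr_gt0; lra.
have p01 : 0 <= p <= 1 by lra.
have p3 : p <= 1 / 3 by nra.
have [k3 kn _ _ [_ _ _ N4]] := block_size n3 nN.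
set k := (N %/ n)%N in k3 kn N4.
pose b := (n.-1)./2.
have [b1 b2 b0 kb kb2] := centre_size n3 kn; rewrite -/b in b1 b2 b0 kb kb2.
have V2 : (N <= 2 * #|outer N b k|)%N.
  by apply: leq_trans kb2 _; rewrite leq_mul2l card_outer orbT.
have VR : N%:R <= 2 * #|outer N b k|%:R :> R by rewrite -natrM ler_nat.
have kR : 3 * N%:R <= 4 * (k%:R * n%:R) :> R by rewrite -!natrM ler_nat.
have kR' : 3 / 4 * N%:R <= k%:R * n%:R :> R by move: kR; clear; lra.
have b1R : n%:R <= 2 * b%:R + 2 :> R by rewrite -natrM -natrD ler_nat.
have b2R : 2 * b%:R <= n%:R :> R by rewrite -natrM ler_nat ltnW.
have k0R : 0 <= k%:R :> R by [].
(* The target is [x N / 75], while the star forest yields [d / 6] times at least [N / 2] outer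
   vertices; hence the requirement [12 x <= 75 d]. *)
suff [d [y [hd hy ky]]] : exists (d : nat) (y : R), [/\ 12 * x <= 75 * d%:R,
    forall S : {set 'I_N * 'I_N}, #|S| = b ->
     expect p S (fun E => (#|E| < d)%N%:R) <= expR (- y)
    & 1 <= 3 * (k%:R * y)].
  apply: (@le_trans _ _ (expR (- (#|outer N b k|%:R / 500)))); last first.
    by rewrite ler_expR; lra.
  apply: le_trans (star_forest_tail b0 kb p01 b2 hy ky).
  rewrite !gnp_probE; apply: expect_le => // E _.
  rewrite ler_nat; case: (boolP (_ <= _)) => //= h1; case: (boolP (_ <= _)) => //= h2.
  case/negP: h1; apply: le_trans h2.
  have -> : 75^-1 * (w / ln w) * p * n%:R * N%:R = 75^-1 * x * N%:R.
    by rewrite /x -wE; field; lra.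
  have d0 : 0 <= d%:R :> R by [].
  apply: le_trans (_ : 75^-1 * (75 / 12 * d%:R) * (2 * #|outer N b k|%:R) <= _).
    apply: ler_pM VR; rewrite ?ler0n //; first by nra.
    by rewrite ler_wpM2l ?invr_ge0 ?ler0n //; lra.
  lra.
(* [25 / 4] is the largest [x] for which [d = 1] meets [12 x <= 75 d]. Here [y = p b], and
   [p N >= 1] with [N <= 3 k b] makes attachment likely enough. *)
have [xle|xgt] := lerP x (25 / 4).
  exists 1%N, (p * b%:R); split; first by rewrite mulr1; lra.
    move=> S cS; have := expect_exp_restrict p01 (subxx S) (lexx 0).
    rewrite sub0r mulN1r mulNr cS; apply: le_trans.
    apply: expect_le => // E sE; rewrite (setIidPl sE).
    by case: #|E| => [|c]; rewrite ?expr0 ?expr0n.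
  have pN1 : 1 <= p * N%:R by move: pN; rewrite -[_^-1]mul1r ler_pdivrMr.
  have h1 : k%:R * (298 * n%:R) <= k%:R * (600 * b%:R) :> R.
    by apply: ler_wpM2l => //; lra.
  have h2 : N%:R <= 3 * (k%:R * b%:R) :> R by lra.
  have : p * N%:R <= p * (3 * (k%:R * b%:R)) by rewrite ler_wpM2l // ltW.
  lra.
pose d := Num.truncn (x / 3).
have /andP[dl du] : d%:R <= x / 3 < d.+1%:R by apply: truncn_itv; lra.
rewrite -[d.+1%:R]natr1 in du.
have d0R : 0 < d%:R :> R by lra.
have d0 : (0 < d)%N by rewrite -(ltr0n R).
have dL : d%:R * ln w <= L / 3.
  have : d%:R * ln w <= x / 3 * ln w by apply: ler_wpM2r => //; lra.
  lra.
have dL2 : d%:R * (9 / 2) <= L.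
  have : d%:R * (3 / 2) <= d%:R * ln w by apply: ler_wpM2l => //; lra.
  lra.
(* From [9 d / 2 <= L <= 2 n], where the last bound is the assumption on the size of [N]. *)
have db : (d <= b)%N.
  by rewrite -(ler_nat R); lra.
exists d, ('C(b, d)%:R * p ^+ d * (1 - p) ^+ (b - d)); split; first by lra.
  by move=> S cS; have := expect_card_lt S d p01; rewrite cS.
have hq := @binomial_point_lower b d p w.
have {hq} hq : expR (- (d%:R * ln w) - 3 / 2 * (p * b%:R)) <=
    'C(b, d)%:R * p ^+ d * (1 - p) ^+ (b - d).
  apply: hq; rewrite ?d0 ?db ?(ltW p0) //; first by lra.
  rewrite -(ler_pM2r n0R) (_ : w * _ * _ = L * b%:R); last by rewrite -wE; ring.
  apply: (@le_trans _ _ (L * (2 / 9) * n%:R)).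
    by rewrite ler_wpM2r //; lra.
  by rewrite -mulrA ler_wpM2l //; lra.
(* [d ln w] costs at most [L / 3] and [3 p b / 2] at most [L / 8]. Then
   [k expR (- L) = k n / N >= 3 / 4] suffices. *)
have hq2 : expR (- L) <= 'C(b, d)%:R * p ^+ d * (1 - p) ^+ (b - d).
  apply: le_trans hq; rewrite ler_expR.
  have : p * (2 * b%:R) <= p * n%:R by rewrite ler_wpM2l // ltW.
  lra.
have hkq : k%:R * expR (- L) <= k%:R * ('C(b, d)%:R * p ^+ d * (1 - p) ^+ (b - d)).
  by rewrite ler_wpM2l.
have h34 : 3 / 4 <= k%:R * expR (- L).
  by rewrite expRN ler_pdivlMr ?expR_gt0 // -(ler_pM2r n0R) -mulrA [expR L * _]mulrC expL.
by move: (le_trans h34 hkq); move: (k%:R * _) => z; clear; lra.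
Qed.

(** * From explicit tails to asymptotic statements *)

Lemma eventually_tail_le (eps : R) : 0 < eps ->
  exists n1 : nat, forall n, (n1 <= n)%N -> expR (- (n%:R / 1000)) <= eps / 2 :> R.
Proof.
move=> eps0; exists (Num.truncn (2000 / eps)).+1 => n hn.
have h : 2000 / eps <= n%:R.
  by apply: le_trans (ltW (truncnS_gt _)) _; rewrite ler_nat.
rewrite expRN -[eps / 2]invrK lef_pV2 ?posrE ?expR_gt0 ?invr_gt0 ?divr_gt0 //.
apply: le_trans (expR_ge1Dx _); rewrite invf_div.
have -> : 2 / eps = 2000 / eps / 1000 by field; lra.
lra.
Qed.

End SparseLower.

Theorem theorem1p4 (R : realType) :
  (* (i) *)
  (forall (N : nat -> nat) (p : nat -> R),
     (exists n0 : nat, forall n : nat, (n0 <= n)%N ->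
        [/\ (3 * n <= N n)%N,
            (N n)%:R <= n%:R * expR (R := R) (2 * n%:R),
            0 < p n <= 1
          & ln ((N n)%:R / n%:R : R) / (6 * n%:R) <= p n]) ->
     forall eps : R, 0 < eps -> exists n1 : nat, forall n : nat, (n1 <= n)%N ->
       1 - eps <= gnp_prob (N := N n) (p n)
         (fun E : {set 'I_(N n) * 'I_(N n)} => (4^-1 * p n * n%:R * (N n)%:R <= (ex_path n E)%:R)
                && ((ex_path n E)%:R <= 18 * p n * n%:R * (N n)%:R)))
  /\
  (* (ii) *)
  (forall (N : nat -> nat) (p : nat -> R),
     (exists n0 : nat, forall n : nat, (n0 <= n)%N ->
        [/\ (3 * n <= N n)%N,
            (N n)%:R <= n%:R * expR (R := R) (2 * n%:R),
            0 < p n <= 1,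
            ((N n)%:R : R)^-1 <= p n
          & p n <= ln ((N n)%:R / n%:R : R) / (6 * n%:R)]) ->
     forall eps : R, 0 < eps -> exists n1 : nat, forall n : nat, (n1 <= n)%N ->
       let omega := ln ((N n)%:R / n%:R : R) / (n%:R * p n) in
       1 - eps <= gnp_prob (N := N n) (p n)
         (fun E : {set 'I_(N n) * 'I_(N n)} => (75^-1 * (omega / ln omega) * p n * n%:R * (N n)%:R
                      <= (ex_path n E)%:R)
                && ((ex_path n E)%:R
                      <= 8 * (omega / ln omega) * p n * n%:R * (N n)%:R))).
Proof.
(* Each of the two failure events gets [eps / 2]; [expR (- n / 1000)] dominates all four tail
   bounds, which hold from [n = 300] on. *)
split=> N p [n0 H] eps /eventually_tail_le[n1 Hn1];
  exists (n0 + n1 + 300)%N => n hn.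
- have [|nN _ p01 hp] := H n; first by lia.
  have n300 : (300 <= n)%N by lia.
  have tail : expR (- (n%:R / 1000)) <= eps / 2 :> R by apply: Hn1; lia.
  have pw : 0 <= p n <= 1 by lra.
  apply: le_trans (gnp_prob_and pw _ _).
  have n0R : 0 <= n%:R :> R by [].
  have h1 := ex_path_lower_dense n300 nN p01 hp.
  have h2 := ex_path_upper_dense n300 nN p01 hp.
  have h3 : expR (- (n%:R / 320)) <= expR (- (n%:R / 1000)) :> R.
    by rewrite ler_expR; lra.
  have h4 : expR (- (n%:R / 36)) <= expR (- (n%:R / 1000)) :> R.
    by rewrite ler_expR; lra.
  have := le_trans h1 h3; have := le_trans h2 h4.
  rewrite /predC /=; lra.
- have [|nN Nub p01 pN hp] := H n; first by lia.
  have n300 : (300 <= n)%N by lia.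
  have tail : expR (- (n%:R / 1000)) <= eps / 2 :> R by apply: Hn1; lia.
  have pw : 0 <= p n <= 1 by lra.
  cbv zeta; apply: le_trans (gnp_prob_and pw _ _).
  have n0R : 0 <= n%:R :> R by [].
  have h1 := ex_path_lower_sparse n300 nN Nub p01 pN hp.
  have h2 := ex_path_upper_sparse n300 nN p01 hp.
  have h4 : expR (- n%:R) <= expR (- (n%:R / 1000)) :> R.
    by rewrite ler_expR; lra.
  have := le_trans h2 h4; move: h1.
  rewrite /predC /=; lra.
Qed.
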